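(* Let $\tau$ be a structure with an element-rooted metrization $\tau^{\mathrm{erm}}$. Let $\mathcal{X}_n=(X_n,\rho_{X_n},a_{X_n})$, $n\in\mathbb{N}\cup\{\infty\}$, be elements of $\mathfrak{M}_\bullet(\tau)$. The following are equivalent: (i) $\mathcal{X}_n\to\mathcal{X}_\infty$ with respect to $\check d_{\mathfrak{M}_\bullet}^{\tau^{\mathrm{erm}}}$, i.e. $\check d_{\mathfrak{M}_\bullet}^{\tau^{\mathrm{erm}}}(\mathcal{X}_n,\mathcal{X}_\infty)\to 0$; (ii) there exist a bcm space $M$ and isometric embeddings $f_n\colon X_n\to M$, $n\in\mathbb{N}\cup\{\infty\}$, such that $f_n(X_n)\to f_\infty(X_\infty)$ in the Fell topology as closed subsets of $M$, $f_n(\rho_{X_n})\to f_\infty(\rho_{X_\infty})$ in $M$, and $\tau_{f_n}(a_{X_n})\to\tau_{f_\infty}(a_{X_\infty})$ in $\tau(M)$.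
   Context: A bcm (boundedly-compact metric) space is a non-empty metric space in which every closed ball of finite radius is compact; a rooted bcm space $(X,\rho_X)$ is a bcm space $X$ with a distinguished point $\rho_X$. The metric of $X$ is denoted $d_X$, and $D_X(x,r)=\{y: d_X(x,y)\le r\}$. An isometric embedding is a distance-preserving map (not necessarily onto); an isometry is a bijective one; a map is root-preserving if it sends root to root. A topological embedding is a homeomorphism onto its image. Structure: a functor $\tau$ from the category of bcm spaces (morphisms: isometric embeddings) to the category of metrizable topological spaces (morphisms: topological embeddings). That is, to each bcm space $X$ it assigns a metrizable space $\tau(X)$ and to each isometric embedding $f\colon X\to Y$ a topological embedding $\tau_f\colon\tau(X)\to\tau(Y)$, with $\tau_{\mathrm{id}_X}=\mathrm{id}_{\tau(X)}$ and $\tau_{g\circ f}=\tau_g\circ\tau_f$. $\mathfrak{M}_\bullet(\tau)$: the set of (representatives of) equivalence classes of triples $(X,\rho_X,a_X)$, with $(X,\rho_X)$ a rooted bcm space and $a_X\in\tau(X)$, where $(X,\rho_X,a_X)\sim(Y,\rho_Y,a_Y)$ iff there is a root-preserving isometry $f\colon X\to Y$ with $\tau_f(a_X)=a_Y$. Element-rooted metrization $\tau^{\mathrm{erm}}$ of $\tau$: a choice, for each bcm space $X$, of a metric $d^{\tau^{\mathrm{erm}}}_{X}$ on $\tau(X)\times X$ inducing the product topology, such that for every isometric embedding $f\colon X\to Y$ the map $\tau_f\times f\colon\tau(X)\times X\to\tau(Y)\times Y$ is distance-preserving. Hausdorff metric on compact subsets (including $\emptyset$) of a metric space $M$: $d^H_M(A,B)=\inf\{\varepsilon\ge0: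 A\subseteq B^\varepsilon, B\subseteq A^\varepsilon\}$, where $A^\varepsilon=\{x:\exists y\in A, d_M(x,y)\le\varepsilon\}$ and $\inf\emptyset=\infty$. For a bcm space $M$, closed $A,B\subseteq M$ and $x,y\in M$, $$d^F_{M}((A,x),(B,y))=d_M(x,y)\vee\int_0^\infty e^{-r}\bigl(1\wedge d^H_M(A\cap D_M(x,r),B\cap D_M(y,r))\bigr)dr.$$ The Fell topology on the set of closed subsets of $M$ is generated by the sets $\{A: A\cap K=\emptyset\}$ ($K$ compact) and $\{A: A\cap U\ne\emptyset\}$ ($U$ open). For $\mathcal{X}=(X,\rho_X,a_X)$, $\mathcal{Y}=(Y,\rho_Y,a_Y)$ in $\mathfrak{M}_\bullet(\tau)$, $$\check d_{\mathfrak{M}_\bullet}^{\tau^{\mathrm{erm}}}(\mathcal{X},\mathcal{Y})=\inf_{f,g,Z}\bigl\{d^F_{Z}\bigl((f(X),f(\rho_X)),(g(Y),g(\rho_Y))\bigr)\vee d^{\tau^{\mathrm{erm}}}_{Z}\bigl((\tau_f(a_X),f(\rho_X)),(\tau_g(a_Y),g(\rho_Y))\bigr)\bigr\},$$ the infimum being over all bcm spaces $Z$ and isometric embeddings $f\colon X\to Z$, $g\colon Y\to Z$. *)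

(* Defs.v *)
From HB Require Import structures.
From mathcomp Require Import all_boot all_order all_algebra.
From mathcomp Require Import all_classical all_reals all_analysis.

Set Implicit Arguments.
Unset Strict Implicit.
Unset Printing Implicit Defensive.

Import Order.TTheory GRing.Theory Num.Theory.
Import numFieldNormedType.Exports.

Local Open Scope classical_set_scope.
Local Open Scope ring_scope.

(* The library's [closed_ball] is the closure of an open ball, which in a
   metric space may be strictly smaller than [cball]. *)
Definition cball (R : numDomainType) (M : metricType R) (x : M) (r : R) :
  set M := [set y | mdist x y <= r].

HB.mixin Record Metric_isBoundedlyCompact (R : numDomainType) M
    & Metric R M := {
  bcm_nonempty : [set: M] !=set0 ;
  compact_cball : forall (x : M) (r : R), compact (cball x r)
}.

#[short(type="bcmType")]
HB.structure Definition BoundedlyCompact (R : numDomainType) :=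
  { M of Metric R M & Metric_isBoundedlyCompact R M }.

Record isoemb (R : numDomainType) (X Y : bcmType R) := IsoEmb {
  isoemb_fun :> X -> Y ;
  isoembP : forall x y, mdist (isoemb_fun x) (isoemb_fun y) = mdist x y
}.

Definition id_isoemb (R : numDomainType) (X : bcmType R) : isoemb X X :=
  @IsoEmb R X X id (fun _ _ => erefl).

Definition comp_isoemb (R : numDomainType) (X Y Z : bcmType R)
    (g : isoemb Y Z) (f : isoemb X Y) : isoemb X Z :=
  @IsoEmb R X Z (g \o f)
    (fun x y => etrans (isoembP g (f x) (f y)) (isoembP f x y)).

Definition topological_embedding (S T : topologicalType) (f : S -> T) : Prop :=
  [/\ injective f, continuous f &
      forall U : set S, open U ->
        exists2 V : set T, open V & f @` U = range f `&` V].

Definition is_metric (R : numDomainType) (T : Type) (d : T -> T -> R) : Prop :=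
  [/\ forall x y, 0 <= d x y,
      forall x y, d x y = 0 <-> x = y,
      forall x y, d x y = d y x &
      forall x y z, d x z <= d x y + d y z].

Definition induces_topology (R : numDomainType) (T : topologicalType)
    (d : T -> T -> R) : Prop :=
  forall U : set T, open U <->
    forall x, U x -> exists2 e : R, 0 < e & [set y | d x y < e] `<=` U.

Definition metrizable (R : numDomainType) (T : topologicalType) : Prop :=
  exists d : T -> T -> R, is_metric d /\ induces_topology d.

Record bcm_structure (R : numDomainType) := BcmStructure {
  st_obj :> bcmType R -> topologicalType ;
  st_metrizable : forall X, metrizable R (st_obj X) ;
  st_map : forall X Y : bcmType R, isoemb X Y -> st_obj X -> st_obj Y ;
  st_map_embedding : forall (X Y : bcmType R) (f : isoemb X Y),
    topological_embedding (st_map f) ;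
  st_map_id : forall X : bcmType R, st_map (id_isoemb X) = id ;
  st_map_comp : forall (X Y Z : bcmType R) (g : isoemb Y Z) (f : isoemb X Y),
    st_map (comp_isoemb g f) = st_map g \o st_map f
}.

Arguments st_map {R} tau {X Y} f : rename.

Record er_metrization (R : numDomainType) (tau : bcm_structure R) :=
  ErMetrization {
  erm_dist :> forall X : bcmType R, tau X * X -> tau X * X -> R ;
  erm_metric : forall X, is_metric (@erm_dist X) ;
  erm_topology : forall X,
    @induces_topology R (tau X * X)%type (@erm_dist X) ;
  erm_isometric : forall (X Y : bcmType R) (f : isoemb X Y) (p q : tau X * X),
    erm_dist (st_map tau f p.1, f p.2) (st_map tau f q.1, f q.2) = erm_dist p q
}.

(* Elements of M_bullet(tau) are handled through representing triples;
   [triple_equiv] is the equivalence, and [dcheck_equiv] below shows that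
   [dcheck] only depends on the classes. *)
Record triple (R : numDomainType) (tau : bcm_structure R) := Triple {
  tr_space :> bcmType R ;
  tr_root : tr_space ;
  tr_elt : tau tr_space
}.

Definition triple_equiv (R : numDomainType) (tau : bcm_structure R)
    (X Y : triple tau) : Prop :=
  exists f : isoemb X Y, [/\ bijective f, f (tr_root X) = tr_root Y &
    st_map tau f (tr_elt X) = tr_elt Y].

Section distances.
Variable R : realType.

Definition thickening (M : metricType R) (A : set M) (e : R) : set M :=
  [set x | exists2 y, A y & mdist x y <= e].

(* [ereal_inf set0 = +oo]. *)
Definition hausdorff_dist (M : metricType R) (A B : set M) : \bar R :=
  ereal_inf [set e%:E | e in [set e : R |
    [/\ 0 <= e, A `<=` thickening B e & B `<=` thickening A e]]].

Definition fell_dist (M : bcmType R) (P Q : set M * M) : \bar R :=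
  maxe (mdist P.2 Q.2)%:E
    (\int[lebesgue_measure]_(r in `[0%R, +oo[)
       ((expR (- r))%:E *
        mine 1 (hausdorff_dist (P.1 `&` cball P.2 r) (Q.1 `&` cball Q.2 r))))%E.

Definition dcheck (tau : bcm_structure R) (erm : er_metrization tau)
    (X Y : triple tau) : \bar R :=
  ereal_inf [set v | exists (Z : bcmType R) (f : isoemb X Z) (g : isoemb Y Z),
    v = maxe
      (fell_dist (range f, f (tr_root X)) (range g, g (tr_root Y)))
      (erm Z (st_map tau f (tr_elt X), f (tr_root X))
             (st_map tau g (tr_elt Y), g (tr_root Y)))%:E].

End distances.

Section fell_topology.

Record closed_subset (M : topologicalType) := ClosedSubset {
  closed_subset_set :> set M ;
  closed_subsetP : closed closed_subset_set
}.

Variable M : topologicalType.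

HB.instance Definition _ := gen_eqMixin (closed_subset M).
HB.instance Definition _ := gen_choiceMixin (closed_subset M).

Definition fell_subbase : set (set (closed_subset M)) :=
  [set [set A : closed_subset M | A `&` K = set0] | K in [set K | compact K]]
  `|`
  [set [set A : closed_subset M | A `&` U !=set0] | U in [set U | open U]].

HB.instance Definition _ :=
  isSubBaseTopological.Build (closed_subset M) fell_subbase id.

End fell_topology.

Lemma isoemb_continuous (R : realType) (X Y : bcmType R) (f : isoemb X Y) :
  continuous f.
Proof.
move=> x.
apply/(@metricType_numDomainType.cvgrPdist_lt R Y) => e e0.
apply/metricType_numDomainType.nbhs_mdistP.
by exists e => // y /=; rewrite isoembP.
Qed.

Lemma isoemb_range_closed (R : realType) (X Y : bcmType R) (f : isoemb X Y) :
  closed (range f).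
Proof.
have [x0 _] := @bcm_nonempty R X.
move=> p clp; pose r := mdist (f x0) p + 1.
have K : closed (f @` cball x0 r).
  apply: compact_closed; first exact: metric_hausdorff.
  apply: continuous_compact; last exact: compact_cball.
  exact/continuous_subspaceT/isoemb_continuous.
suff [x _ <-] : (f @` cball x0 r) p by exists x.
apply: K => B pB.
have pC : nbhs p (B `&` [set y | mdist p y < 1]).
  apply: filterI => //.
  by rewrite -metricType_numDomainType.filter_from_mdist_nbhs; exists 1.
have [_ [[x _ <-] [Bfx px]]] := clp _ pC.
exists (f x); split => //; exists x => //; rewrite /cball /= -(isoembP f).
by rewrite (le_trans (metric_triangle _ p _))// lerD2l ltW.
Qed.

Definition isoemb_range (R : realType) (X Y : bcmType R) (f : isoemb X Y) :
  closed_subset Y := ClosedSubset (@isoemb_range_closed R X Y f).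

Section dcheck_equiv.
Variables (R : realType) (tau : bcm_structure R) (erm : er_metrization tau).

Lemma isoemb_eq (X Y : bcmType R) (f g : isoemb X Y) : f =1 g -> f = g.
Proof.
case: f g => f fP [g gP] /funext /= fg; subst g; congr IsoEmb.
exact: Prop_irrelevance.
Qed.

Lemma triple_equiv_sym (X Y : triple tau) :
  triple_equiv X Y -> triple_equiv Y X.
Proof.
move=> [f [[g fK gK] fr fa]].
have gP x y : mdist (g x) (g y) = mdist x y by rewrite -(isoembP f) !gK.
exists (IsoEmb gP); split; first by exists f.
- by rewrite /= -fr fK.
- rewrite -fa -[LHS]/((st_map tau (IsoEmb gP) \o st_map tau f) _).
  rewrite -st_map_comp (_ : comp_isoemb _ _ = id_isoemb X) ?st_map_id//.
  exact: isoemb_eq.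
Qed.

Lemma dcheck_le (X X' Y Y' : triple tau) :
  triple_equiv X X' -> triple_equiv Y Y' ->
  (dcheck erm X Y <= dcheck erm X' Y')%E.
Proof.
move=> [h [[h' _ hK] hr ha]] [k [[k' _ kK] kr ka]].
apply: le_ereal_inf => _ [Z [f [g ->]]].
exists Z, (comp_isoemb f h), (comp_isoemb g k).
rewrite !st_map_comp /= ha ka hr kr.
have -> : range (f \o h) = range f.
  apply/seteqP; split => [_ [x _ <-]|_ [x _ <-]]; first by exists (h x).
  by exists (h' x) => //=; rewrite hK.
have -> // : range (g \o k) = range g.
apply/seteqP; split => [_ [x _ <-]|_ [x _ <-]]; first by exists (k x).
by exists (k' x) => //=; rewrite kK.
Qed.

Lemma dcheck_equiv (X X' Y Y' : triple tau) :
  triple_equiv X X' -> triple_equiv Y Y' ->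
  dcheck erm X Y = dcheck erm X' Y'.
Proof.
move=> XX' YY'; apply/eqP; rewrite eq_le.
by rewrite !dcheck_le//; exact: triple_equiv_sym.
Qed.

End dcheck_equiv.

(* Main.v *)
Require Import Defs.
From HB Require Import structures.
From mathcomp Require Import all_boot all_order all_algebra.
From mathcomp Require Import all_classical all_reals all_analysis.
From mathcomp Require Import measurable_realfun ring lra.
Import Order.TTheory GRing.Theory Num.Theory.
Import numFieldNormedType.Exports.
Local Open Scope classical_set_scope.
Local Open Scope ring_scope.

Set Implicit Arguments.
Unset Strict Implicit.
Unset Printing Implicit Defensive.

(** (i) => (ii).  Choose near-optimal common spaces [Z_n] of [X_n] and [X_oo],
    glue all of them along [X_oo], and let [M] be the union of the images of
    [X_oo] and of the [X_n].  On bounded sets the [X_n] accumulate only at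
    [X_oo], so [M] is boundedly compact.  The structure [tau] only sees bcm
    spaces, and the full gluing is not one; but the union [W_n] of the images
    of [X_n] and [X_oo] embeds isometrically into both [Z_n] and [M], so the
    element-rooted distances measured in [Z_n] and in [M] coincide.

    (ii) => (i).  Take [Z = M].  Fell convergence is uniform closeness on each
    ball with a fixed centre.  Passing to balls of radius [t] around the moving
    roots costs an error only if [t] is close to the distance from the root to
    a point of a well-chosen finite net, which happens on a set of radii of
    small measure. *)

(** * Compactness in metric spaces *)

Section metric_facts.
Variables (R : realType) (M : metricType R).
Implicit Types (x y z : M) (A : set M).

Lemma nbhs_mdistE x A :
  nbhs x A <-> exists2 e : R, 0 < e & forall y, mdist x y < e -> A y.
Proof.
rewrite -metricType_numDomainType.filter_from_mdist_nbhs.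
by split => -[e e0 eA]; exists e.
Qed.

Lemma mdist_continuous x : continuous (mdist x : M -> R^o).
Proof.
move=> y; apply/cvgrPdist_lt => e e0.
apply/nbhs_mdistE; exists e => // z yz.
rewrite distrC ltr_distl.
have := metric_triangle x z y; have := metric_triangle x y z.
by rewrite (metric_sym z y) => ? ?; apply/andP; split; lra.
Qed.

Lemma cball_closed x (r : R) : closed (cball x r).
Proof.
rewrite [cball _ _](_ : _ = mdist x @^-1` [set t : R^o | t <= r])//.
by apply: closed_comp => [y _|]; [exact: mdist_continuous|exact: closed_le].
Qed.

(* Near-covering compactness makes [Koo] keep a positive distance from some
   member of a filter that does not cluster in [Koo]. *)
Lemma compact_bigcup_close (K : nat -> set M) (Koo : set M) :
  (forall n, compact (K n)) -> compact Koo ->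
  (forall e : R, 0 < e -> \forall n \near \oo, K n `<=` thickening Koo e) ->
  compact (Koo `|` \bigcup_n K n).
Proof.
move=> cK cKoo close F PF FK.
have [[z [Kz Fz]]|noclu] := pselect (exists z, Koo z /\ cluster F z).
  by exists z; split => //; left.
(* [G] lets a scale tend to [0] from the right along with [F], so that a separation valid near [G]
   is valid at some positive scale. *)
pose G := filter_prod ((0 : R)^'+) F.
have sep : \forall t \near G, Koo `<=` [set z | t.1 <= mdist z t.2].
  apply: (proj1 (compact_near_coveringP Koo) cKoo _ G
    (fun t z => t.1 <= mdist z t.2) _) => z Kz.
  have : ~ cluster F z by move=> Fz; apply: noclu; exists z.
  move=> /existsNP[U /existsNP[V /not_implyP[FU /not_implyP[]]]].
  move=> /nbhs_mdistE[e e0 eV] UV.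
  exists ([set z' | mdist z z' < e / 2],
      [set t : R * M | t.1 < e / 2 /\ U t.2]) => /=.
    split; first by apply/nbhs_mdistE; exists (e / 2); rewrite // divr_gt0.
    exists ([set d | d < e / 2], U) => /=; last by move=> [? ?] [].
    by split => //; apply: nbhs_right_lt; rewrite divr_gt0.
  move=> [z' [d y]]/= [zz' [de Uy]]; rewrite leNgt; apply/negP => z'y.
  apply: UV; exists y; split => //; apply: eV.
  by have := metric_triangle z z' y; lra.
have [e e0 [B FB eB]] : exists2 e : R, 0 < e & exists2 B, F B &
    forall y z, B y -> Koo z -> e <= mdist z y.
  case: sep => -[D B]/= [D0 FB] DB.
  have [e [De e0]] := filter_ex (filterI D0 (nbhs_right_gt (0 : R))).
  by exists e => //; exists B => // y z By Kz; exact: (DB (e, y)).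
(* From [N] on, the [K n] lie within [e / 2] of [Koo] and hence miss [B]; so [F] contains a finite
   union of compact sets. *)
have [N _ NK] := close (e / 2) (divr_gt0 e0 (ltr0n _ 2)).
have cN : compact (\big[setU/set0]_(i < N) K i) by exact: bigsetU_compact.
have FN : F (\big[setU/set0]_(i < N) K i).
  apply: filterS (filterI FK FB) => y [[Ky|[n _ Kny]] By].
    by have := eB _ _ By Ky; rewrite mdistxx leNgt e0.
  rewrite -(@bigcup_mkord _ N K); exists n => //=.
  rewrite ltnNge; apply/negP => Nn.
  have [z Kz yz] := NK n Nn y Kny.
  by have := eB _ _ By Kz; rewrite metric_sym; lra.
have [y [Ky Fy]] := cN F PF FN.
exists y; split => //; right; move: Ky.
by rewrite -bigcup_mkord => -[n _ Kny]; exists n.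
Qed.

End metric_facts.

Section isometric_maps.
Variables (R : realType) (M : metricType R).

Lemma isometric_continuous (X : metricType R) (f : X -> M) :
  (forall x y : X, mdist (f x) (f y) = mdist x y) -> continuous f.
Proof.
move=> fP x; apply/metricType_numDomainType.cvgrPdist_lt => e e0.
apply/nbhs_mdistE.
by exists e => // y; rewrite fP.
Qed.

(** [M] is merely metric, so compactness comes from [X]: image points within [r] of [y] come from
    the ball of [X] of radius [s] about [x0]. *)
Lemma compact_cball_range (X : bcmType R) (f : X -> M) y (r : R) :
  (forall x x' : X, mdist (f x) (f x') = mdist x x') ->
  compact (cball y r `&` range f).
Proof.
move=> fP; have [x0 _] := @bcm_nonempty R X.
pose s := r + mdist y (f x0).
rewrite (_ : _ `&` _ = f @` cball x0 s `&` cball y r); last first.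
  apply/seteqP; split=> [z [yz [x _ fx]]|_ [[x _ <-] yx]];
    last by split=> //; exists x.
  move: yz; rewrite -fx => yx.
  split=> //; exists x => //; rewrite /cball/= -fP /s.
  have := metric_triangle (f x0) y (f x); rewrite (metric_sym (f x0) y).
  by move: yx; rewrite /cball/=; lra.
apply: compact_closedI; last exact: cball_closed.
apply: continuous_compact; last exact: compact_cball.
exact/continuous_subspaceT/isometric_continuous.
Qed.

End isometric_maps.

(** * Pseudometrics and their metric quotients *)

Record is_pseudometric (R : realType) (T : Type) (d : T -> T -> R) : Prop :=
  IsPseudometric {
  pm_refl : forall x, d x x = 0 ;
  pm_sym : forall x y, d x y = d y x ;
  pm_tri : forall y x z, d x z <= d x y + d y z }.

Lemma is_pseudometric_comp (R : realType) (S T : Type) (h : S -> T)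
    (d : T -> T -> R) :
  is_pseudometric d -> is_pseudometric (fun x y => d (h x) (h y)).
Proof. by case=> dxx dC dT; split => *; [exact: dxx|exact: dC|exact: dT]. Qed.

Lemma mdist_pseudometric (R : realType) (M : metricType R) :
  is_pseudometric (@mdist R M).
Proof.
split=> *; [exact: mdistxx|exact: metric_sym|exact: metric_triangle].
Qed.

Section metric_quotient.
Variables (R : realType) (T : Type) (d : T -> T -> R).
Hypothesis dP : is_pseudometric d.

(** Points are the classes for distance [0], kept as subsets of [T]; the proof is an argument so
    that the instances below can depend on it. *)
Definition mquot (_ : is_pseudometric d) :=
  {A : set T | exists x, A = [set y | d x y = 0]}.

HB.instance Definition _ := gen_eqMixin (mquot dP).
HB.instance Definition _ := gen_choiceMixin (mquot dP).

Let cls (x : T) : mquot dP := exist _ _ (ex_intro _ x erefl).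

Let rep (u : mquot dP) : T := projT1 (cid (projT2 u)).

Let clsK u : cls (rep u) = u.
Proof.
case: u => A Ax; apply: eq_exist; rewrite /rep/=; by case: cid.
Qed.

Let d_ge0 x y : 0 <= d x y.
Proof.
by have := pm_tri dP y x x; rewrite (pm_refl dP) (pm_sym dP y x); lra.
Qed.

Let cls_eq x y : d x y = 0 -> cls x = cls y.
Proof.
move=> xy0; apply: eq_exist.
apply/seteqP; split => z /= z0; apply/eqP; rewrite eq_le d_ge0 andbT.
  by have := pm_tri dP x y z; rewrite (pm_sym dP y x); lra.
by have := pm_tri dP y x z; lra.
Qed.

Let qdist u v := d (rep u) (rep v).

Let qdistxx u : qdist u u = 0. Proof. exact: (pm_refl dP). Qed.

Let qdist_eq0 u v : qdist u v = 0 -> u = v.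
Proof. by move=> /cls_eq; rewrite !clsK. Qed.

Let qdist_sym u v : qdist u v = qdist v u. Proof. exact: (pm_sym dP). Qed.

Let qdist_tri v u w : qdist u w <= qdist u v + qdist v w.
Proof. exact: (pm_tri dP). Qed.

HB.instance Definition _ :=
  isMetric.Build R (mquot dP) qdistxx qdist_eq0 qdist_sym qdist_tri.

Lemma metric_quotient : exists (M : metricType R) (p : T -> M),
  (forall x y, mdist (p x) (p y) = d x y) /\ (forall u, exists x, p x = u).
Proof.
exists (mquot dP : metricType R), cls; split=> [x y|u]; last first.
  by exists (rep u); rewrite clsK.
have rK z : d z (rep (cls z)) = 0.
  have : projT1 (cls (rep (cls z))) (rep (cls z)) by exact: (pm_refl dP).
  by rewrite clsK.
rewrite -[LHS]/(d (rep (cls x)) (rep (cls y))).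
apply/eqP; rewrite eq_le; apply/andP; split.
  have := pm_tri dP x (rep (cls x)) (rep (cls y)).
  have := pm_tri dP y x (rep (cls y)).
  by have := rK x; have := rK y; rewrite (pm_sym dP (rep (cls x)) x); lra.
have := pm_tri dP (rep (cls x)) x y.
have := pm_tri dP (rep (cls y)) (rep (cls x)) y.
by have := rK x; have := rK y; rewrite (pm_sym dP (rep (cls y)) y); lra.
Qed.

End metric_quotient.

(** * Gluing boundedly compact spaces *)

Section bcm_of_metric.
Variables (R : realType) (M : metricType R).
Hypothesis M0 : [set: M] !=set0.
Hypothesis cM : forall (x : M) (r : R), compact (cball x r).

(* The proofs are arguments so that the instances below can depend on them. *)
Definition bcm_carrier (_ : [set: M] !=set0)
  (_ : forall (x : M) (r : R), compact (cball x r)) : Type := M.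

HB.instance Definition _ := Metric.copy (bcm_carrier M0 cM) M.
HB.instance Definition _ :=
  Metric_isBoundedlyCompact.Build R (bcm_carrier M0 cM) M0 cM.

Definition bcm_of_metric : bcmType R := bcm_carrier M0 cM.

End bcm_of_metric.

Section gluing.
Variables (R : realType) (T : Type) (d : T -> T -> R).
Hypothesis dP : is_pseudometric d.
Variables (X : nat -> bcmType R) (Y : bcmType R) (rho : Y).
Variables (i : forall n, X n -> T) (j : Y -> T).
Hypothesis iP : forall n x x', d (@i n x) (@i n x') = mdist x x'.
Hypothesis jP : forall y y', d (j y) (j y') = mdist y y'.
Hypothesis ijT : forall t, (exists y, t = j y) \/ (exists n x, t = @i n x).
Hypothesis close : forall r e : R, 0 < e -> \forall n \near \oo,
  forall x, d (j rho) (@i n x) <= r -> exists y, d (@i n x) (j y) <= e.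

(** By [ijT], a ball of the quotient is a closed part of the union of its traces on the [X n] and of
    a larger trace on [Y]. By [close], the former accumulate only at the latter, so
    [compact_bigcup_close] applies. *)
Lemma gluing : exists (B : bcmType R) (p : T -> B),
  (forall x y, mdist (p x) (p y) = d x y) /\ (forall u, exists x, p x = u).
Proof.
have [M [p [pP pT]]] := metric_quotient dP.
have piP n (x x' : X n) : mdist (p (@i n x)) (p (@i n x')) = mdist x x'.
  by rewrite pP iP.
have pjP (y y' : Y) : mdist (p (j y)) (p (j y')) = mdist y y'.
  by rewrite pP jP.
have cM (u : M) r : compact (cball u r).
  (* The extra [1] keeps in [Koo] the points of [Y] near [cball u r]; hence the tolerance
     [Num.min e 1] below. *)
  pose Koo := cball u (r + 1) `&` range (p \o j).
  pose K n := cball u r `&` range (p \o @i n).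
  have cK : compact (Koo `|` \bigcup_n K n).
    apply: compact_bigcup_close => [n||e e0].
    - exact: compact_cball_range (piP n).
    - exact: compact_cball_range pjP.
    have m0 : 0 < Num.min e 1 by rewrite lt_min e0 ltr01.
    apply: filterS (close (mdist (p (j rho)) u + r) m0) => n nclose v.
    move=> [ur [x _ ux]].
    have [|y xy] := nclose x.
      rewrite -pP; have := metric_triangle (p (j rho)) u (p (@i n x)).
      by move: ur; rewrite -ux /cball/=; lra.
    move: xy; rewrite le_min -pP => /andP[xe x1].
    exists (p (j y)); last by rewrite -ux.
    split; last by exists y.
    have := metric_triangle u (p (@i n x)) (p (j y)).
    by move: ur; rewrite -ux /cball/=; lra.
  apply: subclosed_compact cK _; first exact: cball_closed.
  move=> v uv; have [t tv] := pT v; case: (ijT t) => [[y ty]|[n [x tx]]].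
    left; split; last by exists y => //=; rewrite -ty.
    by move: uv; rewrite /cball/=; lra.
  by right; exists n => //; split => //; exists x => //=; rewrite -tx.
have M0 : [set: M] !=set0 by exists (p (j rho)).
by exists (bcm_of_metric M0 cM), p.
Qed.

End gluing.

Section hull.
Variables (R : realType) (X Y : bcmType R) (T : Type) (d : T -> T -> R).
Hypothesis dP : is_pseudometric d.
Variables (i : X -> T) (j : Y -> T).
Hypothesis iP : forall x x', d (i x) (i x') = mdist x x'.
Hypothesis jP : forall y y', d (j y) (j y') = mdist y y'.

(** This gives [tau] a space to act on, namely the union of two images in [T], where [T] itself need
    not be a bcm space. *)
Lemma hull : exists (W : bcmType R) (u : isoemb X W) (v : isoemb Y W),
  [/\ forall x y, mdist (u x) (v y) = d (i x) (j y) &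
      forall w, (exists x, w = u x) \/ (exists y, w = v y)].
Proof.
pose h (s : X + Y) := match s with inl x => i x | inr y => j y end.
have hP := is_pseudometric_comp h dP.
(* The sequence [X, Y, Y, ...] makes closeness trivial: from index [1] on, all points lie in the
   image of [Y]. *)
pose Xs n := if n is 0 then X else Y.
pose f n : Xs n -> X + Y := match n with 0 => inl | _.+1 => inr end.
have [rho _] := @bcm_nonempty R Y.
have [||||W [p [pP pT]]] := @gluing R _ _ hP Xs Y rho f inr.
- by case=> [|n] x x' /=; [exact: iP|exact: jP].
- exact: jP.
- by case=> [x|y]; [right; exists 0, x|left; exists y].
- move=> r e e0; exists 1%N => // -[//|n] _ y _.
  by exists y; rewrite /= (pm_refl dP) ltW.
have uP x x' : mdist (p (inl x)) (p (inl x')) = mdist x x' by rewrite pP iP.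
have vP y y' : mdist (p (inr y)) (p (inr y')) = mdist y y' by rewrite pP jP.
exists W, (IsoEmb uP), (IsoEmb vP); split=> [x y|w]; first exact: pP.
by have [[x|y] <-] := pT w; [left; exists x|right; exists y].
Qed.

End hull.

(* The two coordinate axes of the l1 product. *)
Lemma common_bcm (R : realType) (X Y : bcmType R) :
  exists (W : bcmType R) (u : isoemb X W) (v : isoemb Y W), True.
Proof.
have [a _] := @bcm_nonempty R X; have [b _] := @bcm_nonempty R Y.
pose d (p q : X * Y) := mdist p.1 q.1 + mdist p.2 q.2.
have dP : is_pseudometric d.
  split=> [p|p q|q p r]; rewrite /d.
  - by rewrite !mdistxx addr0.
  - by rewrite (metric_sym p.1) (metric_sym p.2).
  - by have := metric_triangle p.1 q.1 r.1;
      have := metric_triangle p.2 q.2 r.2; lra.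
have [||W [u [v _]]] := @hull R X Y _ d dP (fun x => (x, b)) (fun y => (a, y)).
- by move=> x x'; rewrite /d/= mdistxx addr0.
- by move=> y y'; rewrite /d/= mdistxx add0r.
by exists W, u, v.
Qed.

(** * Amalgamation of metric spaces along a common subspace *)

Section amalgam.
Variables (R : realType) (Z : nat -> metricType R) (Y : bcmType R).
Variables (g : forall n, Y -> Z n).
Hypothesis gP : forall n y y', mdist (@g n y) (@g n y') = mdist y y'.

Let P := {n : nat & Z n}.
Let c (p : P) (y : Y) : R := mdist (tagged p) (@g (tag p) y).
Let S (p q : P) : set R := range (fun y => c p y + c q y).

(** Between two pieces this is the infimal length of a route through [Y]. Corresponding points of
    the copies of [Y] are not identified but lie at distance [0], so this is only a pseudometric. *)
Definition amalgam_dist (p q : P) : R :=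
  if tag p == tag q then mdist (tagged p) (tagged_as p q)
  else inf [set mdist (tagged p) (@g (tag p) y) +
                mdist (tagged q) (@g (tag q) y) | y in [set: Y]].

Let a := amalgam_dist.

Let has_infS p q : has_inf (S p q).
Proof.
split; first by have [y _] := @bcm_nonempty R Y; exists (c p y + c q y), y.
by exists 0 => _ [y _ <-]; rewrite addr_ge0// mdist_ge0.
Qed.

Lemma amalgam_dist_fiber n (u v : Z n) :
  amalgam_dist (Tagged Z u) (Tagged Z v) = mdist u v.
Proof. by rewrite /amalgam_dist /= eqxx tagged_asE. Qed.

(** Within one piece this is the triangle inequality, so uses need not ask whether the end points
    share a piece. *)
Let a_le p q y : a p q <= c p y + c q y.
Proof.
rewrite /a /amalgam_dist; case: eqP => [pq|_].
  case: p q pq => n u [m v] /= nm; subst m; rewrite tagged_asE/=.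
  rewrite /c/=; have := metric_triangle u (@g n y) v.
  by rewrite (metric_sym v).
by apply: ge_inf; [case: (has_infS p q)|exists y].
Qed.

Let a_ge p q e : tag p != tag q -> 0 < e ->
  exists y, c p y + c q y < a p q + e.
Proof.
move=> /negPf pq e0; rewrite /a /amalgam_dist pq.
by have [_ [y _ <-]] := inf_adherent e0 (has_infS p q); exists y.
Qed.

Let c_fiber p q y : tag p = tag q -> c p y <= a p q + c q y.
Proof.
case: p q => n u [m v] /= nm; subst m.
by rewrite /a amalgam_dist_fiber; exact: metric_triangle.
Qed.

Let c_tri q y y' : mdist y y' <= c q y + c q y'.
Proof.
by rewrite -(gP (tag q)) /c (metric_sym _ (g _ y)); exact: metric_triangle.
Qed.

Let c_le q y y' : c q y <= c q y' + mdist y' y.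
Proof. by rewrite -(gP (tag q)) /c; exact: metric_triangle. Qed.

Let a_sym p q : a p q = a q p.
Proof.
rewrite /a /amalgam_dist; case: (eqVneq (tag p) (tag q)) => [pq|pq].
  case: p q pq => n u [m v] /= nm; subst m.
  by rewrite !tagged_asE metric_sym.
by congr inf; apply/seteqP; split => _ [y _ <-]; exists y => //; rewrite addrC.
Qed.

Let a_tri_fiber p q r : tag p = tag q -> a p r <= a p q + a q r.
Proof.
move=> pq; have [qr|qr] := eqVneq (tag q) (tag r).
  case: p q r pq qr => n u [m v] [k w] /= nm mk; subst m k.
  by rewrite /a !amalgam_dist_fiber metric_triangle.
apply/ler_addgt0Pl => e e0; have [y yP] := a_ge qr e0.
by have := a_le p r y; have := c_fiber y pq; lra.
Qed.

(** If [q] shares a piece with [p] or [r], [a_tri_fiber] applies. Otherwise near-optimal routes to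
    [q] pass through some [y] and [y'], and [c_tri] bounds the distance between these by the detour
    via [q]. *)
Lemma amalgam_pseudometric : is_pseudometric amalgam_dist.
Proof.
split=> [[n u]|p q|q p r]; [|exact: a_sym|].
  by rewrite amalgam_dist_fiber mdistxx.
have [pq|pq] := eqVneq (tag p) (tag q); first exact: a_tri_fiber.
have [rq|rq] := eqVneq (tag r) (tag q).
  have := a_tri_fiber p rq.
  by rewrite (a_sym r p) (a_sym r q) (a_sym q p) addrC.
apply/ler_addgt0Pl => e e0; have e2 : 0 < e / 2 by rewrite divr_gt0.
have [y yP] := a_ge pq e2; rewrite eq_sym in rq; have [y' y'P] := a_ge rq e2.
have := a_le p r y; have := c_le r y y'; have := c_tri q y y'.
by rewrite (metric_sym y' y) -/a; lra.
Qed.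

(** A route from a point of [Y] gains nothing by passing through another one, since [g] is
    isometric. The copy of [Y] is thus immaterial, and distances to [X_oo] measured in [Z_n] survive
    the gluing. *)
Lemma amalgam_dist_base n y q :
  amalgam_dist (Tagged Z (@g n y)) q = mdist (tagged q) (@g (tag q) y).
Proof.
rewrite -/a -/(c q y); apply/eqP; rewrite eq_le; apply/andP; split.
  by have := a_le (Tagged Z (@g n y)) q y; rewrite {1}/c/= mdistxx add0r.
have [nq|nq] := eqVneq n (tag q).
  case: q nq => m v /= nm; subst m.
  by rewrite /a amalgam_dist_fiber /c/= metric_sym.
apply/ler_addgt0Pl => e e0.
have [//|y' ] := @a_ge (Tagged Z (@g n y)) q e _ e0.
rewrite {1}/c/= gP; have := c_le q y y'; rewrite (metric_sym y'); lra.
Qed.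

End amalgam.

(** * Fell convergence in a bcm space *)

Lemma cvg_fell_subbase (M : topologicalType) (F : set_system (closed_subset M))
    (A : closed_subset M) : Filter F ->
  F --> A <-> forall U, @fell_subbase M U -> U A -> F U.
Proof.
move=> FF; split=> [FA U sU UA|sF B].
  apply: FA; exists U; split=> //; exists [set U]; last first.
    by rewrite predeqE => ?; split=> [[_ ->]|] //; exists U.
  by move=> _ ->; exact: (finI_from1 id).
rewrite /= (@nbhsE (closed_subset M)) => -[_ [[D sD <-] [C DC CA]] sDB].
rewrite nbhs_filterE; apply: filterS sDB _; apply: (@filterS _ _ _ C).
  by move=> ? ?; exists C.
have /sD [E sE IEC] := DC; rewrite -IEC; apply: filter_bigI => U EU.
have /set_mem sU := sE _ EU; apply: sF => //.
by move: CA; rewrite -IEC => /(_ U EU).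
Qed.

Section fell_convergence.
Variables (R : realType) (M : bcmType R).

(** Missing compact sets corresponds to the first inclusion, hitting open sets to the second. *)
Lemma fell_cvgP (A : nat -> closed_subset M) (B : closed_subset M) :
  A n @[n --> \oo] --> B <->
  forall (x : M) (r e : R), 0 < e -> \forall n \near \oo,
    A n `&` cball x r `<=` thickening B e /\
    B `&` cball x r `<=` thickening (A n) e.
Proof.
split=> [/cvg_fell_subbase AB x r e e0|close].
  apply: filterI.
    (* The points of the ball at distance at least [e] from all of [B] form a compact set disjoint
       from [B], which [A n] eventually misses. *)
    pose K := cball x r `&` \bigcap_(b in B) [set y | e <= mdist b y].
    have clK : closed (\bigcap_(b in B) [set y : M | e <= mdist b y]).
      apply: closed_bigI => b _.
      rewrite [X in closed X](_ : _ = mdist b @^-1` [set t : R^o | e <= t])//.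
      apply: closed_comp => [y _|]; last exact: closed_ge.
      exact: mdist_continuous.
    have cK : compact K by apply: compact_closedI => //; exact: compact_cball.
    have BK : B `&` K = set0.
      apply/seteqP; split => // b [Bb [_ /(_ b Bb)]].
      by rewrite /= mdistxx leNgt e0.
    have : \forall n \near \oo, A n `&` K = set0.
      apply: (AB [set C : closed_subset M | C `&` K = set0]) => //.
      by left; exists K.
    apply: filterS => n AK y [Ay xy]; apply: contrapT => By.
    suff : (A n `&` K) y by rewrite AK.
    split=> //; split=> // b Bb; rewrite /= leNgt; apply/negP => be.
    by apply: By; exists b => //; rewrite metric_sym ltW.
  have cB : compact (B `&` cball x r).
    rewrite setIC; apply: compact_closedI; first exact: compact_cball.
    exact: closed_subsetP.
  (* Near [b], hitting one open set serves all points; compactness makes the rank uniform over [B]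
     in the ball. *)
  apply: (proj1 (compact_near_coveringP _) cB nat \oo
    (fun n y => thickening (A n) e y) _) => b [Bb _].
  have e2 : 0 < e / 2 by rewrite divr_gt0.
  have bU : nbhs b (ball b (e / 2)) by exact: nbhsx_ballx.
  pose U := interior (ball b (e / 2)).
  have nearA : \forall n \near \oo, A n `&` U !=set0.
    apply: (AB [set C : closed_subset M | C `&` U !=set0]); last by exists b.
    by right; exists U => //; exact: open_interior.
  exists (ball b (e / 2), [set n | A n `&` U !=set0]) => //.
  move=> [y n] /= [yb [a [Aa /interior_subset ab]]]; exists a => //.
  move: yb ab; rewrite !ballEmdist/=; have := metric_triangle y b a.
  by rewrite (metric_sym y b); lra.
apply/cvg_fell_subbase => _ [[K cK <-]|[U oU <-]] /=.
- move=> BK; suff : \forall n \near \oo, K `<=` ~` A n.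
    by apply: filterS => n KA; apply/seteqP; split => // y [Ay /KA].
  apply: (proj1 (compact_near_coveringP _) cK nat \oo
    (fun n y => (~` A n) y) _) => k Kk.
  have : nbhs k (~` B).
    apply: open_nbhs_nbhs; split; first exact/closed_openC/closed_subsetP.
    by move=> Bk; have : (B `&` K) k by []; rewrite BK.
  move=> /nbhs_mdistE[e e0 eB]; have e2 : 0 < e / 2 by rewrite divr_gt0.
  exists (ball k (e / 2),
      [set n | A n `&` cball k e `<=` thickening B (e / 2)]).
    split; first exact: nbhsx_ballx.
    by apply: filterS (close k e _ e2) => n [].
  move=> [y n] /= [ky AB] Ay; move: ky; rewrite ballEmdist/= => ky.
  have [|b Bb yb] := AB y; first by split => //; rewrite /cball/=; lra.
  by apply: (eB b _ Bb); have := metric_triangle k y b; lra.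
- move=> [b [Bb Ub]].
  have /nbhs_mdistE[e e0 eU] : nbhs b U by exact: open_nbhs_nbhs.
  have e2 : 0 < e / 2 by rewrite divr_gt0.
  (* Radius [0] suffices, since the ball only has to contain [b]. *)
  apply: filterS (close b 0 _ e2) => n [_ BA].
  have [|a Aa ba] := BA b; first by split => //; rewrite /cball/= mdistxx.
  by exists a; split => //; apply: eU; lra.
Qed.

End fell_convergence.

(** * Estimates for the Fell distance *)

(** If [P K] fails, the sets whose complement in [K] satisfies [P] form a proper filter containing
    [K]; the local hypothesis fails at a cluster point of it. *)
Lemma compact_induction (T : topologicalType) (K : set T) (P : set T -> Prop) :
  compact K -> P set0 ->
  (forall A B, P A -> P B -> P (A `|` B)) ->
  (forall A B, A `<=` B -> P B -> P A) ->
  (forall x, K x -> exists2 U, nbhs x U & P (U `&` K)) ->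
  P K.
Proof.
move=> cK P0 PU PS loc; apply: contrapT => NPK.
pose F : set_system T := [set B | P (K `\` B)].
have FF : ProperFilter F.
  split; first by rewrite /F/= setD0.
  split; first by rewrite /F/= setDT.
  - by move=> A B; rewrite /F/= setDIr; exact: PU.
  - by move=> A B AB; rewrite /F/=; apply: PS; exact: setDS.
have [|x [Kx Fx]] := cK F FF; first by rewrite /F/= setDv.
have [U xU PUK] := loc x Kx.
have FU : F (~` U) by rewrite /F/= setDE setCK setIC.
by have [y []] := Fx _ _ FU xU.
Qed.

(* On each cell of a fine cover of [K] keep a point minimising the distance
   to [x]. *)
Lemma finite_inner_net (R : realType) (M : metricType R) (K : set M) (x : M)
    (e : R) :
  0 < e -> compact K -> exists s : seq M, (forall t, t \in s -> K t) /\
    forall a, K a ->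
    exists t, [/\ t \in s, mdist a t <= e & mdist x t <= mdist x a].
Proof.
move=> e0 cK.
suff [s [sK sP]] : exists s : seq M, (forall t, t \in s -> K t) /\
    forall a, (K `&` K) a ->
    exists t, [/\ t \in s, mdist a t <= e & mdist x t <= mdist x a].
  by exists s; split => // a Ka; exact: sP.
apply: (@compact_induction _ K (fun B => exists s : seq M,
    (forall t, t \in s -> K t) /\ forall a, (B `&` K) a ->
    exists t, [/\ t \in s, mdist a t <= e & mdist x t <= mdist x a])) => //.
- by exists [::]; split => // a [].
- move=> A B [s [sK sA]] [s' [s'K sB]]; exists (s ++ s'); split.
    by move=> t; rewrite mem_cat => /orP[/sK|/s'K].
  move=> a [[Aa|Ba] Ka].
    have [|t [ts at' xt]] := sA a; first by split.
    by exists t; rewrite mem_cat ts.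
  have [|t [ts at' xt]] := sB a; first by split.
  by exists t; rewrite mem_cat ts orbT.
- move=> A B AB [s [sK sP]]; exists s; split=> // a [/AB Ba Ka].
  exact: sP.
- move=> z Kz; have e2 : 0 < e / 2 by rewrite divr_gt0.
  exists (cball z (e / 2)).
    by apply/nbhs_mdistE; exists (e / 2) => // y /ltW.
  pose C := K `&` cball z (e / 2).
  have cC : compact C by apply: compact_closedI => //; exact: cball_closed.
  have C0 : C !=set0 by exists z; split => //; rewrite /cball/= mdistxx ltW.
  have [|t tC tmin] := @compact_EVT_min M R (mdist x) C C0 cC.
    exact/continuous_subspaceT/mdist_continuous.
  have [Kt zt] := set_mem tC; exists [:: t]; split.
    by move=> ?; rewrite inE => /eqP ->.
  move=> a [[za _] Ka]; exists t; rewrite mem_head; split => //; last first.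
    by apply: tmin; apply: mem_set; split.
  have := metric_triangle a z t; rewrite (metric_sym a z).
  by move: za zt; rewrite /cball/=; lra.
Qed.

(* The integral of a nonnegative function is a supremum over simple functions
   below it, so it is monotone even on nonmeasurable integrands; this spares us
   the measurability of the integrand of [fell_dist]. *)
Lemma ge0_le_integral_nonmeas d (T : measurableType d) (R : realType)
    (mu : measure T R) (D : set T) (f g : T -> \bar R) :
  (forall x, D x -> (0 <= f x)%E) -> (forall x, D x -> (f x <= g x)%E) ->
  (\int[mu]_(x in D) f x <= \int[mu]_(x in D) g x)%E.
Proof.
move=> f0 fg.
have g0 x : D x -> (0 <= g x)%E.
  by move=> Dx; exact: le_trans (f0 x Dx) (fg x Dx).
rewrite !ge0_integralE//; apply: ereal_sup_le.
move=> _ [h hf <-]; exists h => // x; apply: le_trans (hf x) _.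
by rewrite /patch; case: ifPn => // /set_mem; exact: fg.
Qed.

Section hausdorff.
Variables (R : realType) (M : metricType R).
Implicit Types A B : set M.

Lemma thickeningS A (e e' : R) : e <= e' -> thickening A e `<=` thickening A e'.
Proof. by move=> ee' x [y Ay xy]; exists y => //; exact: le_trans ee'. Qed.

Lemma hausdorff_dist_ge0 A B : (0 <= hausdorff_dist A B)%E.
Proof. by apply: le_ereal_inf_tmp => _ [e [e0 _ _] <-]; rewrite lee_fin. Qed.

Lemma hausdorff_dist_le A B e : 0 <= e -> A `<=` thickening B e ->
  B `<=` thickening A e -> (hausdorff_dist A B <= e%:E)%E.
Proof. by move=> *; apply: ereal_inf_lbound; exists e. Qed.

Lemma hausdorff_dist_lt A B e : (hausdorff_dist A B < e%:E)%E ->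
  A `<=` thickening B e /\ B `<=` thickening A e.
Proof.
move=> /ereal_inf_lt[_ [e' [_ AB BA] <-]]; rewrite lte_fin => /ltW ee'.
by split; [apply: subset_trans AB _|apply: subset_trans BA _];
  exact: thickeningS.
Qed.

End hausdorff.

Section fell_dist.
Variables (R : realType) (M : bcmType R).
Implicit Types A B : set M.
Local Notation mu := (@lebesgue_measure R).

Let gap A B x y (t : R) : \bar R :=
  mine 1%E (hausdorff_dist (A `&` cball x t) (B `&` cball y t)).

Let gap_ge0 A B x y t : (0 <= gap A B x y t)%E.
Proof. by rewrite le_min lee01 hausdorff_dist_ge0. Qed.

(** If the traces were at least [e] apart at every radius in [[r, r + 1]], where the weight is at
    least [expR (- (r + 1))], the integral would reach the bound. A good radius [s] in this interval
    then serves for [r]. *)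
Lemma fell_dist_close A B x y (r e : R) : 0 <= r -> 0 < e -> e <= 1 ->
  (fell_dist (A, x) (B, y) < (expR (- (r + 1)) * e)%:E)%E ->
  [/\ mdist x y <= e, A `&` cball x r `<=` thickening B e &
      B `&` cball y r `<=` thickening A e].
Proof.
move=> r0 e0 e1; rewrite /fell_dist gt_max /= lte_fin => /andP[xy].
move=> small.
have [s [rs sr1 /hausdorff_dist_lt[AB BA]]] : exists s,
    [/\ r <= s, s <= r + 1 &
      (hausdorff_dist (A `&` cball x s) (B `&` cball y s) < e%:E)%E].
  apply: contrapT => /forallNP big; move: small; apply/negP; rewrite -leNgt.
  (* [k] bounds the integrand from below on an interval of length [1]. *)
  pose k := expR (- (r + 1)) * e.
  have k0 : 0 <= k by rewrite mulr_ge0 ?expR_ge0 ?ltW.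
  have -> : k%:E = (\int[mu]_(t in `[0%R, +oo[)
      (k%:E * (\1_(`[r, r + 1]%classic) t)%:E))%E.
    rewrite ge0_integralZl_EFin//; last exact/measurable_EFinP/measurable_indic.
    rewrite integral_indic// setIidl; last first.
      move=> t /=; rewrite !in_itv/= andbT => /andP[rt _]; exact: le_trans rt.
    rewrite [X in (_ * X)%E](_ : _ = 1%E) ?mule1//.
    have /= := lebesgue_measure_itv `[r, r + 1].
    by rewrite lte_fin ltrDl ltr01 -EFinB (_ : r + 1 - r = 1)//; lra.
  apply: ge0_le_integral_nonmeas => t _.
    by rewrite mule_ge0// lee_fin.
  rewrite indicE; case: (boolP (t \in _)) => /= [|_]; last first.
    by rewrite mule0 mule_ge0// ?lee_fin ?expR_ge0// gap_ge0.
  rewrite inE/= in_itv/= => /andP[rt tr]; rewrite mule1 /k EFinM.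
  apply: lee_pmul.
  - by rewrite lee_fin expR_ge0.
  - by rewrite lee_fin ltW.
  - by rewrite lee_fin ler_expR lerN2.
  rewrite le_min lee_fin e1/= leNgt; apply/negP => lt_e.
  by apply: (big t); split.
split=> [|z [Az xz]|z [Bz yz]].
- apply: le_trans (ltW xy) _; apply: ler_piMl; first exact: ltW.
  by rewrite expR_le1; lra.
- have [|w [Bw _] zw] := AB z; last by exists w.
  by split => //; exact: le_trans rs.
- have [|w [Aw _] zw] := BA z; last by exists w.
  by split => //; exact: le_trans rs.
Qed.

(** The integrand is bounded by [G3] on radii beyond [rho], by [G2] on radii within [2 * d] of the
    distance from [x] to a net point, and by [G1] on the others, where the traces are [d + e / 8]
    close. *)
Lemma fell_dist_small B x (e : R) : closed B -> 0 < e ->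
  exists r d : R, 0 < d /\ forall A y, mdist y x <= d ->
    A `&` cball x r `<=` thickening B d ->
    B `&` cball x r `<=` thickening A d ->
    (fell_dist (A, y) (B, x) <= e%:E)%E.
Proof.
move=> clB e0.
have [rho rho0 rhoe] : exists2 rho : R, 0 <= rho &
    2 * expR (- (rho / 2)) <= e / 4.
  (* This solves [expR (- (rho / 2)) = e / 8]; the maximum covers [e > 8]. *)
  exists (Num.max 0 (- 2 * ln (e / 8))); first by rewrite le_max lexx.
  have -> : e / 4 = 2 * (e / 8) by lra.
  rewrite ler_pM2l// -[leRHS]lnK ?posrE ?divr_gt0// ler_expR.
  have : - 2 * ln (e / 8) <= Num.max 0 (- 2 * ln (e / 8)).
    by rewrite le_max lexx orbT.
  by lra.
have e8 : 0 < e / 8 by rewrite divr_gt0.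
have cK : compact (B `&` cball x (rho + 1)).
  by rewrite setIC; apply: compact_closedI; [exact: compact_cball|].
have [s [sK net]] := finite_inner_net x e8 cK.
pose N : R := (size s)%:R.
have N0 : 0 <= N by rewrite ler0n.
(* The three bounds make [G1] cost at most [e / 4], keep [t + 2 * d] below [rho + 1], and make the
   [N] intervals of length [4 * d] cost at most [e / 4]; [N + 1] avoids a zero denominator. *)
pose d := Num.min (e / 8) (Num.min (1 / 4) (e / (16 * (N + 1)))).
have d0 : 0 < d.
  by rewrite !lt_min !divr_gt0// mulr_gt0//; lra.
have [d1 [d2 d3]] : [/\ d <= e / 8, d <= 1 / 4 & 4 * d * N <= e / 4].
  have [] : [/\ d <= e / 8, d <= 1 / 4 & d <= e / (16 * (N + 1))].
    by split; rewrite !ge_min lexx ?orbT.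
  move=> -> -> dN; split=> //; move: dN; rewrite ler_pdivlMr => [dN|]; last lra.
  have E : d * (16 * (N + 1)) = 16 * (d * N) + 16 * d by ring.
  by rewrite E in dN; rewrite -mulrA; lra.
exists (rho + 1), d; split=> // A y yx AB BA.
rewrite /fell_dist ge_max /= lee_fin; apply/andP; split; first lra.
pose I (p : M) : set R := `[mdist x p - 2 * d, mdist x p + 2 * d]%classic.
(* Exponential densities serve as majorants with integral at most [1]. In [G3], half of the exponent
   of [expR (- t)] pays for the tail beyond [rho]. *)
pose G1 (t : R) : \bar R := ((d + e / 8)%:E * (exponential_pdf 1 t)%:E)%E.
pose G2 (t : R) : \bar R := (\sum_(p <- s) (\1_(I p) t)%:E)%E.
pose G3 (t : R) : \bar R :=
  ((2 * expR (- (rho / 2)))%:E * (exponential_pdf (1 / 2) t)%:E)%E.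
have pdf0 (c t : R) : 0 <= c -> (0 <= (exponential_pdf c t)%:E :> \bar R)%E.
  by move=> c0; rewrite lee_fin exponential_pdf_ge0.
have G10 (t : R) : (0 <= G1 t)%E by rewrite mule_ge0 ?pdf0 // lee_fin; lra.
have G20 (t : R) : (0 <= G2 t)%E by apply: sume_ge0 => p _; rewrite lee_fin.
have G30 (t : R) : (0 <= G3 t)%E.
  by rewrite mule_ge0 ?pdf0 // lee_fin mulr_ge0 ?expR_ge0.
pose D : set (measurableTypeR R) := `[0%R, +oo[%classic.
have mpdf (c : R) : measurable_fun D (fun t => (exponential_pdf c t)%:E).
  apply/measurable_EFinP; apply: measurable_funTS.
  exact: measurable_exponential_pdf.
have mI p : measurable (I p : set (measurableTypeR R)) by exact: measurable_itv.
have mI' p : measurable_fun D (fun t : R => (\1_(I p) t)%:E).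
  by apply/measurable_EFinP; exact: measurable_indic.
have mG1 : measurable_fun D G1.
  by apply: measurable_funeM; exact: mpdf.
have mG2 : measurable_fun D G2.
  exact: emeasurable_fun_sum.
have mG3 : measurable_fun D G3.
  by apply: measurable_funeM; exact: mpdf.
have int_pdf (c : R) : 0 < c ->
    (\int[mu]_(t in `[0%R, +oo[) (exponential_pdf c t)%:E <= 1)%E.
  move=> c0; rewrite -(integral_exponential_pdf c0).
  apply: ge0_subset_integral => //; last by move=> t _; exact/pdf0/ltW.
  by apply/measurable_EFinP; exact: measurable_exponential_pdf.
apply: (@le_trans _ _ (\int[mu]_(t in `[0%R, +oo[) (G1 t + G2 t + G3 t))%E).
  apply: ge0_le_integral_nonmeas => t.
    by rewrite mule_ge0 ?gap_ge0// lee_fin expR_ge0.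
  rewrite /= in_itv/= andbT => t0.
  have le_exp : ((expR (- t))%:E * gap A B y x t <= (expR (- t))%:E)%E.
    rewrite -[leRHS]mule1; apply: lee_wpmul2l.
      by rewrite lee_fin expR_ge0.
    by rewrite ge_min lexx.
  have [trho|rhot] := leP t rho; last first.
    apply: le_trans le_exp _; rewrite -[leLHS]add0e leeD//.
      exact: adde_ge0.
    rewrite /G3 exponential_pdfE// -EFinM lee_fin.
    rewrite mulrACA [_ * (1 / 2)](_ : _ = 1) ?mul1r; last lra.
    by rewrite -expRD ler_expR; lra.
  have [[p [ps Ip]]|good] := pselect (exists p, p \in s /\ I p t).
    apply: le_trans le_exp _; apply: (@le_trans _ _ (G2 t)); last first.
      by rewrite -[leLHS]adde0 leeD// leeDr.
    rewrite /G2 (big_rem p)//= indicE mem_set//.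
    apply: (@le_trans _ _ 1%E).
      by rewrite lee_fin expR_le1; lra.
    by rewrite leeDl// sume_ge0// => ? _; rewrite lee_fin.
  rewrite -[leLHS]adde0 leeD//.
  rewrite -[leLHS]adde0 leeD//.
  rewrite /G1 exponential_pdfE// mul1r mulN1r muleC.
  apply: lee_wpmul2r; first by rewrite lee_fin expR_ge0.
  rewrite ge_min; apply/orP; right.
  (* At a good radius, a net point within [t + 2 * d] of [x] is already within [t - 2 * d]. Net
     points are no farther from [x] than the points they replace, so this applies to them. *)
  have far p : p \in s -> mdist x p <= t + 2 * d -> mdist x p < t - 2 * d.
    move=> ps pt; rewrite ltNge; apply/negP => tp.
    apply: good; exists p; split=> //; rewrite /I/= in_itv/=.
    by apply/andP; split; lra.
  apply: hausdorff_dist_le; first lra.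
  - move=> a [Aa ya]; rewrite /cball/= in ya.
    have xa := metric_triangle x y a; rewrite (metric_sym x y) in xa.
    have [|b Bb ab] := AB a; first by split => //; rewrite /cball/=; lra.
    have xb := metric_triangle x a b.
    have [|p [ps bp xp]] := net b; first by split => //; rewrite /cball/=; lra.
    have tp : mdist x p < t - 2 * d by apply: far => //; lra.
    have [Bp _] := sK p ps.
    exists p; first by split => //; rewrite /cball/=; lra.
    by have := metric_triangle a b p; lra.
  - move=> b [Bb xb]; rewrite /cball/= in xb.
    have [|p [ps bp xp]] := net b; first by split => //; rewrite /cball/=; lra.
    have tp : mdist x p < t - 2 * d by apply: far => //; lra.
    have [Bp xp'] := sK p ps.
    (* Of the slack [2 * d], one [d] pays for moving from [p] to [a], the other for moving the
       centre to [y]. *)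
    have [|a Aa pa] := BA p; first by [].
    exists a; last by have := metric_triangle b p a; lra.
    split => //; rewrite /cball/=.
    by have := metric_triangle y x a; have := metric_triangle x p a; lra.
rewrite ge0_integralD//; last 2 first.
  by move=> t _; exact: adde_ge0.
  exact: emeasurable_funD.
rewrite ge0_integralD//.
have -> : e = (d + e / 8) + (e / 4) + (e - d - e / 8 - e / 4) by lra.
rewrite !EFinD; apply: leeD; first apply: leeD.
- rewrite ge0_integralZl_EFin//; last 2 first.
    by move=> t _; exact: pdf0.
    by lra.
  by rewrite -[leRHS]mule1 lee_wpmul2l ?lee_fin ?int_pdf//; lra.
- rewrite ge0_integral_sum//.
  apply: (@le_trans _ _ (\sum_(p <- s) (4 * d)%:E)%E).
    apply: lee_sum => p _; rewrite integral_indic//.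
    apply: (@le_trans _ _ (mu (I p))).
      by apply: le_measure; rewrite ?inE//; exact: measurableI.
    have /= := lebesgue_measure_itv `[mdist x p - 2 * d, mdist x p + 2 * d].
    rewrite lte_fin ifT; last lra.
    by rewrite -EFinB => ->; rewrite lee_fin; lra.
  rewrite sumEFin lee_fin big_const_seq count_predT iter_addr addr0.
  rewrite -[leLHS]mulr_natr.
  exact: d3.
- rewrite ge0_integralZl_EFin; last 4 first.
    by [].
    by move=> t _; apply: pdf0; lra.
    exact: mpdf.
    by rewrite mulr_ge0 ?expR_ge0.
  apply: (@le_trans _ _ ((2 * expR (- (rho / 2)))%:E * 1)%E).
    by rewrite lee_wpmul2l ?lee_fin ?mulr_ge0 ?expR_ge0// int_pdf.
  by rewrite mule1 -!EFinD lee_fin; lra.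
Qed.

End fell_dist.

(** * Convergence expressed through distances *)

Section induced_topology.
Variables (R : realType) (T : topologicalType) (d : T -> T -> R).
Hypotheses (dP : is_metric d) (dT : induces_topology d).

Lemma induced_nbhsP x (A : set T) :
  nbhs x A <-> exists2 e : R, 0 < e & forall y, d x y < e -> A y.
Proof.
have [_ d0 dC dtri] := dP; split=> [|[e e0 eA]].
  rewrite nbhsE => -[U [/dT oU Ux] UA]; have [e e0 eU] := oU x Ux.
  by exists e => // y xy; apply: UA; exact: eU.
rewrite nbhsE; exists [set y | d x y < e] => //; split; last first.
  by rewrite /= (d0 x x).2.
apply/dT => y /= xy; exists (e - d x y); first by rewrite subr_gt0.
by move=> z /= yz; have := dtri x y z; lra.
Qed.

Lemma induced_cvgP (u : nat -> T) x : u n @[n --> \oo] --> x <->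
  forall e : R, 0 < e -> \forall n \near \oo, d x (u n) < e.
Proof.
split=> [ux e e0|ux A /induced_nbhsP[e e0 eA]].
  by apply: (ux [set y | d x y < e]); apply/induced_nbhsP; exists e.
by apply: filterS (ux e e0) => n; exact: eA.
Qed.

End induced_topology.

Lemma cvge0P (R : realType) (u : nat -> \bar R) : (forall n, 0 <= u n)%E ->
  u n @[n --> \oo] --> 0%E <->
  forall e : R, 0 < e -> \forall n \near \oo, (u n <= e%:E)%E.
Proof.
move=> u0; split=> [/fine_cvgP[ufin /cvgrPdist_le u_cvg] e e0|ule].
  apply: filterS2 ufin (u_cvg e e0) => n un; rewrite sub0r normrN => une.
  by rewrite -(fineK un) lee_fin (le_trans (ler_norm _)).
apply/fine_cvgP; split.
  apply: filterS (ule 1 ltr01) => n un1.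
  by rewrite fin_numElt (lt_le_trans _ (u0 n))// (le_lt_trans un1)// ltry.
apply/cvgrPdist_le => e e0; apply: filterS (ule e e0) => n une.
rewrite sub0r normrN ger0_norm; last exact: fine_ge0.
rewrite -lee_fin fineK// fin_numElt (lt_le_trans _ (u0 n))//.
by rewrite (le_lt_trans une)// ltry.
Qed.

(** * Independence of the ambient space *)

(** A point of [W] reached from both sides has a single image, because cross distances agree and
    distance [0] means equality; so [f] and [g] paste together. *)
Lemma hull_map (R : realType) (X Y W Z : bcmType R) (u : isoemb X W)
    (v : isoemb Y W) (f : isoemb X Z) (g : isoemb Y Z) :
  (forall x y, mdist (u x) (v y) = mdist (f x) (g y)) ->
  (forall w, (exists x, w = u x) \/ (exists y, w = v y)) ->
  exists k : isoemb W Z, comp_isoemb k u = f /\ comp_isoemb k v = g.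
Proof.
move=> uv cov.
have /choice[k kP] : forall w, exists z,
    (forall x, w = u x -> z = f x) /\ (forall y, w = v y -> z = g y).
  move=> w; have [[x ->]|[y ->]] := cov w.
    exists (f x); split=> [x' xx'|y xy]; apply: mdist_positivity.
      by rewrite isoembP -(isoembP u) xx' mdistxx.
    by rewrite -uv xy mdistxx.
  exists (g y); split=> [x yx|y' yy']; apply: mdist_positivity.
    by rewrite metric_sym -uv yx mdistxx.
  by rewrite isoembP -(isoembP v) yy' mdistxx.
have ku x : k (u x) = f x by have [+ _] := kP (u x); exact.
have kv y : k (v y) = g y by have [_] := kP (v y); exact.
have kiso w w' : mdist (k w) (k w') = mdist w w'.
  have [[x ->]|[y ->]] := cov w; have [[x' ->]|[y' ->]] := cov w';
    rewrite ?ku ?kv ?isoembP ?uv//.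
  by rewrite metric_sym -uv metric_sym.
by exists (IsoEmb kiso); split; exact: isoemb_eq.
Qed.

(* Both sides can be measured in the union of the images of [X] and [Y]. *)
Lemma erm_cross (R : realType) (tau : bcm_structure R)
    (erm : er_metrization tau) (X Y Z M : bcmType R)
    (f : isoemb X Z) (g : isoemb Y Z) (F : isoemb X M) (G : isoemb Y M)
    (p : tau X * X) (q : tau Y * Y) :
  (forall x y, mdist (F x) (G y) = mdist (f x) (g y)) ->
  erm M (st_map tau F p.1, F p.2) (st_map tau G q.1, G q.2) =
  erm Z (st_map tau f p.1, f p.2) (st_map tau g q.1, g q.2).
Proof.
move=> FG; have [||W [u [v [uv cov]]]] :=
  @hull R X Y _ _ (mdist_pseudometric Z) f g; [exact: isoembP|exact: isoembP|].
have ermW (N : bcmType R) (a : isoemb X N) (b : isoemb Y N) :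
    (forall x y, mdist (u x) (v y) = mdist (a x) (b y)) ->
    erm N (st_map tau a p.1, a p.2) (st_map tau b q.1, b q.2) =
    erm W (st_map tau u p.1, u p.2) (st_map tau v q.1, v q.2).
  move=> /hull_map /(_ cov) [k [<- <-]]; rewrite !st_map_comp.
  by rewrite -(erm_isometric erm k).
by rewrite (ermW Z)// (ermW M)// => x y; rewrite FG.
Qed.

(** * Near-optimal common embeddings *)

Section dcheck_cvg.
Variables (R : realType) (tau : bcm_structure R) (erm : er_metrization tau).

Definition embedding_cost (X Y : triple tau) (Z : bcmType R) (f : isoemb X Z)
    (g : isoemb Y Z) : \bar R :=
  maxe (fell_dist (range f, f (tr_root X)) (range g, g (tr_root Y)))
    (erm Z (st_map tau f (tr_elt X), f (tr_root X))
           (st_map tau g (tr_elt Y), g (tr_root Y)))%:E.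

Lemma dcheck_ge0 (X Y : triple tau) : (0 <= dcheck erm X Y)%E.
Proof.
apply: le_ereal_inf_tmp => _ [Z [f [g ->]]].
by rewrite !le_max lee_fin mdist_ge0.
Qed.

(** When [dcheck] is [+oo] any common space will do, which is where [common_bcm] enters; a choice
    thus exists for every pair. *)
Lemma dcheck_approx (X Y : triple tau) (e : R) : 0 < e ->
  exists s : {Z : bcmType R & (isoemb X Z * isoemb Y Z)%type},
    (embedding_cost (projT2 s).1 (projT2 s).2 <= dcheck erm X Y + e%:E)%E.
Proof.
move=> e0; have [->|] := eqVneq (dcheck erm X Y) +oo%E.
  have [W [u [v _]]] := common_bcm X Y.
  by exists (existT _ W (u, v)); rewrite addye// leey.
rewrite -ltey => fin.
have : (dcheck erm X Y < dcheck erm X Y + e%:E)%E.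
  by rewrite lteDl ?lte_fin// ge0_fin_numE// dcheck_ge0.
move=> /ereal_inf_lt[_ [Z [f [g ->]]] /ltW le_e].
by exists (existT _ Z (f, g)).
Qed.

(** The roots are within [e <= 1] of each other, so balls of radius [r] about the root of [Y] fit in
    balls of radius [r + 1] about that of [X]; hence the second [+ 1] in the exponent. *)
Lemma embedding_cost_close (X Y : triple tau) (Z : bcmType R) (f : isoemb X Z)
    (g : isoemb Y Z) (r e : R) : 0 <= r -> 0 < e -> e <= 1 ->
  (embedding_cost f g < (expR (- (r + 1 + 1)) * e)%:E)%E ->
  (forall x, mdist (f x) (g (tr_root Y)) <= r ->
     exists y, mdist (f x) (g y) <= e) /\
  (forall y, mdist y (tr_root Y) <= r -> exists x, mdist (f x) (g y) <= e).
Proof.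
move=> r0 e0 e1; rewrite /embedding_cost gt_max => /andP[fell _].
have [|rho XY YX] := fell_dist_close _ e0 e1 fell; first lra.
split=> [x xr|y yr].
  have [|_ [y _ <-] xy] := XY (f x); last by exists y.
  split; first by exists x.
  have := metric_triangle (f (tr_root X)) (g (tr_root Y)) (f x).
  by rewrite /cball/= (metric_sym (g _) (f x)); lra.
have [|_ [x _ <-] xy] := YX (g y); last by exists x; rewrite metric_sym.
split; first by exists y.
by rewrite /cball/= isoembP metric_sym; lra.
Qed.

End dcheck_cvg.

(** * Convergence for [dcheck] and convergence in a common space *)

Theorem theorem6p25 (R : realType) (tau : bcm_structure R)
    (erm : er_metrization tau) (X : nat -> triple tau) (Xoo : triple tau) :
  (dcheck erm (X n) Xoo @[n --> \oo] --> 0%E)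
  <->
  (exists (M : bcmType R) (f : forall n, isoemb (X n) M) (foo : isoemb Xoo M),
    [/\ isoemb_range (f n) @[n --> \oo] --> isoemb_range foo,
        f n (tr_root (X n)) @[n --> \oo] --> foo (tr_root Xoo) &
        st_map tau (f n) (tr_elt (X n)) @[n --> \oo]
          --> st_map tau foo (tr_elt Xoo)]).
Proof.
split; last first.
  move=> [M [f [foo [/fell_cvgP fell_cvg root_cvg elt_cvg]]]].
  apply/cvge0P => [n|e e0]; first exact: dcheck_ge0.
  have [r [d [d0 small]]] := fell_dist_small (foo (tr_root Xoo))
    (@isoemb_range_closed R _ _ foo) e0.
  (* Here (ii) => (i) is under way. [erm] metrizes the product, so elements and roots are taken
     together. *)
  have pair_cvg : (st_map tau (f n) (tr_elt (X n)), f n (tr_root (X n)))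
      @[n --> \oo] --> (st_map tau foo (tr_elt Xoo), foo (tr_root Xoo)).
    exact: cvg_pair.
  have erm_small := proj1 (induced_cvgP (@erm_metric _ _ erm M)
    (@erm_topology _ _ erm M) _ _) pair_cvg e e0.
  have /metricType_numDomainType.cvgrPdist_lt/(_ d d0) root_small := root_cvg.
  apply: filterS3 (fell_cvg (foo (tr_root Xoo)) r d d0) root_small erm_small.
  move=> n [AB BA] root_d erm_e.
  apply: (@le_trans _ _ (embedding_cost erm (f n) foo)).
    by apply: ereal_inf_lbound; exists M, (f n), foo.
  rewrite ge_max; apply/andP; split.
    by apply: small => //; rewrite metric_sym ltW.
  have [_ _ ermC _] := @erm_metric _ _ erm M.
  by rewrite lee_fin ermC ltW.
(* Now (i) => (ii). The data [s n] chosen below are optimal up to [1 / (n + 1)]. *)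
move=> /(proj1 (cvge0P (fun n => dcheck_ge0 erm (X n) Xoo))) dcheck0.
have inv0 n : 0 < n.+1%:R^-1 :> R by rewrite invr_gt0.
pose s n := projT1 (cid (dcheck_approx erm (X n) Xoo (inv0 n))).
pose Z n : metricType R := projT1 (s n).
pose f n : isoemb (X n) (projT1 (s n)) := (projT2 (s n)).1.
pose g n : isoemb Xoo (projT1 (s n)) := (projT2 (s n)).2.
have cost0 (e : R) : 0 < e ->
    \forall n \near \oo, (embedding_cost erm (f n) (g n) < e%:E)%E.
  move=> e0; have e2 : 0 < e / 2 by rewrite divr_gt0.
  apply: filterS2 (dcheck0 _ e2) (near_infty_natSinv_lt (PosNum e2)) => n d2 n2.
  apply: le_lt_trans (projT2 (cid (dcheck_approx erm (X n) Xoo (inv0 n)))) _.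
  rewrite [e]splitr EFinD lee_ltD// fin_numElt (le_lt_trans d2) ?ltry//.
  by rewrite (lt_le_trans _ (dcheck_ge0 _ _ _)).
have close (r e : R) : 0 < e -> \forall n \near \oo,
    (forall x, mdist (f n x) (g n (tr_root Xoo)) <= r ->
       exists y, mdist (f n x) (g n y) <= e) /\
    (forall y, mdist y (tr_root Xoo) <= r ->
       exists x, mdist (f n x) (g n y) <= e).
  (* Clamping meets the bounds [0 <= r] and [e <= 1] of [embedding_cost_close]. *)
  move=> e0; pose r' := Num.max r 0; pose e' := Num.min e 1.
  have r'0 : 0 <= r' by rewrite le_max lexx orbT.
  have rr' : r <= r' by rewrite le_max lexx.
  have e'0 : 0 < e' by rewrite lt_min e0 ltr01.
  have e'1 : e' <= 1 by rewrite ge_min lexx orbT.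
  have e'e : e' <= e by rewrite ge_min lexx.
  have c0 : 0 < expR (- (r' + 1 + 1)) * e' by rewrite mulr_gt0 ?expR_gt0.
  apply: filterS (cost0 _ c0) => n /(embedding_cost_close r'0 e'0 e'1)[XY YX].
  split=> [x xr|y yr].
    have [|y xy] := XY x; first exact: le_trans rr'.
    by exists y; exact: le_trans e'e.
  have [|x xy] := YX y; first exact: le_trans rr'.
  by exists x; exact: le_trans e'e.
have gP n y y' : mdist (g n y : Z n) (g n y') = mdist y y' by exact: isoembP.
have aP := amalgam_pseudometric gP.
(* Only [Xoo] and the [X n] are kept. [Xoo] enters through its copy in [Z 0], but any copy gives the
   same distances. *)
pose h (t : Xoo + {n : nat & X n}) : {n : nat & Z n} := match t with
  | inl y => Tagged Z (g 0 y : Z 0)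
  | inr p => Tagged Z (f (tag p) (tagged p) : Z (tag p)) end.
have hP := is_pseudometric_comp h aP.
pose i n (x : X n) : Xoo + {n : nat & X n} := inr (Tagged (fun n => X n) x).
pose j (y : Xoo) : Xoo + {n : nat & X n} := inl y.
have cross n (x : X n) y :
    amalgam_dist (fun n => g n) (h (i n x)) (h (j y)) = mdist (f n x) (g n y).
  by rewrite (pm_sym aP) (amalgam_dist_base gP).
have [|||r e e0|M [p [pP _]]] := @gluing R _ _ hP (fun n => X n) Xoo
    (tr_root Xoo) i j.
- by move=> n x x'; rewrite amalgam_dist_fiber; exact: isoembP.
- by move=> y y'; rewrite amalgam_dist_fiber; exact: isoembP.
- by case=> [y|[n x]]; [left; exists y|right; exists n, x].
- apply: filterS (close r e e0) => n [XY _] x; rewrite (pm_sym aP) cross => xr.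
  by have [y xy] := XY x xr; exists y; rewrite cross.
have Fiso n x x' : mdist (p (i n x)) (p (i n x')) = mdist x x'.
  by rewrite pP amalgam_dist_fiber; exact: isoembP.
have Fooiso y y' : mdist (p (j y)) (p (j y')) = mdist y y'.
  by rewrite pP amalgam_dist_fiber; exact: isoembP.
pose F n : isoemb (X n) M := IsoEmb (Fiso n).
pose Foo : isoemb Xoo M := IsoEmb Fooiso.
have FFoo n x y : mdist (F n x) (Foo y) = mdist (f n x) (g n y).
  by rewrite /= pP cross.
have pair_cvg : (st_map tau (F n) (tr_elt (X n)), F n (tr_root (X n)))
    @[n --> \oo] --> (st_map tau Foo (tr_elt Xoo), Foo (tr_root Xoo)).
  apply/(induced_cvgP (@erm_metric _ _ erm M) (@erm_topology _ _ erm M)).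
  move=> e e0.
  apply: filterS (cost0 e e0) => n; rewrite gt_max => /andP[_].
  rewrite lte_fin; have [_ _ -> _] := @erm_metric _ _ erm M.
  (* The distance in [M] is carried back to [Z n], where [cost0] bounds it. *)
  by rewrite (erm_cross erm (tr_elt (X n), tr_root (X n))
    (tr_elt Xoo, tr_root Xoo) (FFoo n)).
exists M, F, Foo; split.
- apply/fell_cvgP => z r e e0.
  (* The ball about [z] is enlarged to one about the root, where [close] applies. *)
  apply: filterS (close (r + mdist z (Foo (tr_root Xoo))) e e0) => n [XY YX].
  split=> _ [[t _ <-] zt]; rewrite /cball/= in zt.
    have [|y ty] := XY t.
      rewrite -FFoo; have := metric_triangle (F n t) z (Foo (tr_root Xoo)).
      by rewrite (metric_sym (F n t) z) /=; lra.
    by exists (Foo y); [exists y|rewrite FFoo].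
  have [|x xy] := YX t.
    rewrite -(isoembP Foo).
    have := metric_triangle (Foo t) z (Foo (tr_root Xoo)).
    by rewrite (metric_sym (Foo t) z) /=; lra.
  by exists (F n x); [exists x|rewrite metric_sym FFoo].
- exact: (cvg_comp _ _ pair_cvg cvg_snd).
- exact: (cvg_comp _ _ pair_cvg cvg_fst).
Qed.
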